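(* Let $A$ be an $n\times n$ invertible matrix over a field and let $A=PLUQ$ be a PLUQ decomposition computed by Gaussian elimination with a pivoting strategy minimizing the reverse lexicographic order and performing row rotations. Set $\overline{L}=PLP^T$, $E=PQ$, $\overline{U}=Q^TUQ$. Then $A=\overline{L}E\overline{U}$ is the unique modified Bruhat decomposition of $A$, i.e. the unique factorization of $A$ as a product $\overline{L}E\overline{U}$ with $\overline{L}$ unit lower triangular, $E$ a permutation matrix, $\overline{U}$ upper triangular, such that $E^T\overline{L}E$ is also lower triangular.
   Context: A PLUQ decomposition of an invertible $n\times n$ matrix $A$ is $A=PLUQ$ with $P,Q$ permutation matrices, $L$ unit lower triangular and $U$ nonsingular upper triangular. Gaussian elimination computes it one pivot at a time: at step $k$ a nonzero pivot is searched in the current remaining matrix (the Schur complement of the previous pivots, on the still unprocessed rows and columns in their current order), it is moved to diagonal position $(k,k)$ by a row permutation and a column permutation, and the elimination update $a_{i,j}\leftarrow a_{i,j}-a_{i,k}a_{k,k}^{-1}a_{k,j}$ is applied to the remaining rows and columns. Minimizing the reverse lexicographic order means that the pivot is the topmost nonzero element of the first nonzero column of the remaining matrix. Row rotations means that a pivot in row $i\ge k$ is brought to row $k$ by the cyclic shift that moves row $i$ to position $k$ and shifts rows $k,\dots,i-1$ down by one, preserving their order. *)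

(* Defs.v *)
From mathcomp Require Import all_boot all_order all_fingroup all_algebra.

Set Implicit Arguments.
Unset Strict Implicit.
Unset Printing Implicit Defensive.

Import GRing.Theory.
Local Open Scope ring_scope.

(* A permutation s acts on rows through [row_perm s], which puts the old row   *)
(* s p at position p.  [lift_perm k i 1] sends k to i and is the increasing   *)
(* bijection between the complements of k and of i, so for k <= i it brings   *)
(* row i to position k and shifts rows k, ..., i - 1 down by one.             *)
Definition rotation (n : nat) : 'I_n -> 'I_n -> 'S_n :=
  match n return 'I_n -> 'I_n -> 'S_n with
  | 0 => fun _ _ => 1%g
  | n'.+1 => fun k i => lift_perm k i 1%g
  end.

Lemma rotationE (n : nat) (k i p : 'I_n) : (k <= i)%N ->
  rotation k i p =
    (if p == k then i : nat else if (k < p <= i)%N then p.-1 else p) :> nat.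
Proof.
case: n k i p => [|n] k i p; first by case: k.
move=> le_ki /=; case: (unliftP k p) => [j ->|->]; last first.
  by rewrite lift_perm_id eqxx.
rewrite lift_perm_lift perm1 eq_sym (negPf (neq_lift k j)) /= /bump.
have [lt_jk | le_kj] := ltnP j k; have [lt_ji | le_ij] := ltnP j i;
  rewrite ?add0n ?add1n ?ltnS ?lt_jk ?le_kj ?lt_ji ?le_ij //=.
  by rewrite ltnNge (ltnW lt_jk).
by have := leq_trans lt_jk (leq_trans le_ki le_ij); rewrite ltnn.
Qed.

Section PLUQ.
Variables (F : fieldType) (n : nat).
Implicit Types (A W L E U P Q : 'M[F]_n) (k : 'I_n).

Definition revlex_le (u v : 'I_n * 'I_n) : bool :=
  (u.2 < v.2)%N || (u.2 == v.2) && (u.1 <= v.1)%N.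

Definition candidate k W (u : 'I_n * 'I_n) : bool :=
  [&& (k <= u.1)%N, (k <= u.2)%N & W u.1 u.2 != 0].

Definition is_pivot k W (u : 'I_n * 'I_n) : bool :=
  candidate k W u && [forall v, candidate k W v ==> revlex_le u v].

(* Only row permutations are prescribed to be rotations; column permutations  *)
(* may be either of the two usual kinds.                                      *)
Inductive col_move := ColTransposition | ColRotation.

Definition col_move_perm (c : col_move) (k j : 'I_n) : 'S_n :=
  match c with
  | ColTransposition => tperm k j
  | ColRotation => rotation k j
  end.

(* In-place elimination: the multiplier of row i at step k is stored in the   *)
(* position (i, k) that it annihilates, so that later row permutations move   *)
(* it along with its row.                                                     *)
Definition eliminate k W : 'M[F]_n :=
  \matrix_(i, j)
    if (k < i)%N && (k < j)%N then W i j - W i k * (W k k)^-1 * W k j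
    else if (k < i)%N && (j == k) then W i k * (W k k)^-1
    else W i j.

(* (W, s, t): the working matrix, whose position (i, j) corresponds to the    *)
(* entry (s i, t j) of the input.                                             *)
Definition gauss_state : Type := ('M[F]_n * 'S_n * 'S_n)%type.

(* The step is void when the remaining matrix is zero, which does not happen  *)
(* on invertible inputs.                                                      *)
Definition gauss_step (c : col_move) (S : gauss_state) k : gauss_state :=
  let: (W, s, t) := S in
  if [pick u | is_pivot k W u] is Some (i, j) then
    let r := rotation k i in
    let q := col_move_perm c k j in
    (eliminate k (row_perm r (col_perm q W)), (r * s)%g, (q * t)%g)
  else S.

Definition gauss (c : col_move) A : gauss_state :=
  foldl (gauss_step c) (A, 1%g, 1%g) (enum 'I_n).

Definition unit_lower_part W : 'M[F]_n :=
  \matrix_(i, j) if (j < i)%N then W i j else (i == j)%:R.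

Definition upper_part W : 'M[F]_n :=
  \matrix_(i, j) if (i <= j)%N then W i j else 0.

(* With (W, s, t) the final state, the matrix with entries A (s i) (t j) is   *)
(* L *m U, that is, A = P *m L *m U *m Q for the P and Q below.               *)
Definition gauss_PLUQ (c : col_move) A (P L U Q : 'M[F]_n) : Prop :=
  let: (W, s, t) := gauss c A in
  [/\ P = perm_mx s^-1, L = unit_lower_part W, U = upper_part W
    & Q = perm_mx t].

Definition lower_triangular L : bool := is_trig_mx L.

Definition upper_triangular U : bool := is_trig_mx U^T.

Definition unit_lower_triangular L : bool :=
  lower_triangular L && [forall i, L i i == 1].

Definition modified_Bruhat A L E U : Prop :=
  [/\ A = L *m E *m U,
      unit_lower_triangular L,
      is_perm_mx E,
      upper_triangular U
    & lower_triangular (E^T *m L *m E)].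

End PLUQ.

(* Main.v *)
(* The remaining matrix of an invertible A is invertible, so its first column *)
(* never vanishes: every pivot lies in the current column and Q = 1.  Row     *)
(* rotations keep the unprocessed rows in their original order, so a topmost  *)
(* pivot only eliminates rows lying below it in A, and P L P^T is still lower *)
(* triangular.  Uniqueness is that of the Bruhat permutation, the condition   *)
(* on E^T L E making the triangular factors unique as well.                   *)

Require Import Defs.
From mathcomp Require Import all_boot all_order all_fingroup all_algebra.
From mathcomp Require Import zify.

Set Implicit Arguments.
Unset Strict Implicit.
Unset Printing Implicit Defensive.

Import GRing.Theory.
Local Open Scope ring_scope.

(** Existence rests on [gauss_invariant]: after [k] steps the row-permuted input is
    [partial_L k W *m partial_U k W], unprocessed rows are in their original order, and a nonzero
    multiplier always sits in a row that came from below its pivot row. At the end this last fact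
    says that [P *m L *m P^T] is lower triangular; since [Q] is the identity, conjugating it back by
    [E = P] returns [L], which is lower triangular as well.

    Uniqueness ([modified_Bruhat_uniq]) compares any two such factorizations: the quotient of their
    upper factors is upper triangular, which forces equal permutations; it is then unit lower
    triangular too, hence the identity. *)

Lemma eq_perm_of_leq (n : nat) (s t : 'S_n) :
  (forall i, (s i <= t i)%N) -> s = t.
Proof.
move=> le_st; apply/permP => i; apply/val_inj => /=.
(* All permutations have the same sum of values, so no inequality can be strict. *)
have /leqif_sum [_] :
    forall i : 'I_n, true -> (s i <= t i ?= iff (s i == t i :> nat))%N.
  by move=> j _; split.
have sumE (u : 'S_n) : (\sum_(i < n) u i = \sum_(i < n) i)%N.
  by rewrite [RHS](reindex_inj (@perm_inj _ u)).
by rewrite !sumE eqxx => /esym/forallP/(_ i)/eqP.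
Qed.

(** * Triangular matrices and uniqueness of the factorization *)

Section Triangular.
Variables (F : fieldType) (n : nat).
Implicit Types (A B L E U : 'M[F]_n).

Lemma trig_mulmx_diag A B i :
  is_trig_mx A -> is_trig_mx B -> (A *m B) i i = A i i * B i i.
Proof.
move=> /is_trig_mxP trA /is_trig_mxP trB; rewrite mxE (bigD1 i) //= big1 ?addr0 //.
move=> l ne_li; have [lt_li | lt_il | /val_inj eq_li] := ltngtP l i.
- by rewrite trB ?mulr0.
- by rewrite trA ?mul0r.
- by rewrite eq_li eqxx in ne_li.
Qed.

(** Forward substitution: once the rows of [B] above [i] are known to be triangular, the entry
    [(i, j)] of the product, for [i < j], reduces to [A i i * B i j]. *)
Lemma trig_mulmx_cancel A B :
  is_trig_mx A -> (forall i, A i i != 0) -> is_trig_mx (A *m B) -> is_trig_mx B.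
Proof.
move=> /is_trig_mxP trA nzA /is_trig_mxP trAB; apply/is_trig_mxP.
suff IH m (i j : 'I_n) : (i < m)%N -> (i < j)%N -> B i j = 0.
  by move=> i j; apply: (IH i.+1).
elim: m i j => // m IHm i j lt_im lt_ij.
have := trAB _ _ lt_ij; rewrite mxE (bigD1 i) //= big1 => [|l ne_li].
  by rewrite addr0 => /eqP; rewrite mulf_eq0 (negPf (nzA i)) => /eqP.
have [lt_li | lt_il | /val_inj eq_li] := ltngtP l i.
- by rewrite IHm ?mulr0 //; lia.
- by rewrite trA ?mul0r.
- by rewrite eq_li eqxx in ne_li.
Qed.

Lemma trig_unitmx_diag A i : is_trig_mx A -> A \in unitmx -> A i i != 0.
Proof.
by move=> trA; rewrite unitmxE det_trig // unitfE => /prodf_neq0; apply.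
Qed.

Lemma unit_lower_unitmx L : unit_lower_triangular L -> L \in unitmx.
Proof.
case/andP => trL /forallP L1; rewrite unitmxE det_trig // big1 ?unitr1 //.
by move=> i _; apply/eqP.
Qed.

(* In the Leibniz expansion, every permutation maps some row i >= k to some   *)
(* column j <= k, as there are fewer columns > k than rows >= k.              *)
Lemma det_zero_block U (k : 'I_n) :
  (forall i j : 'I_n, (k <= i)%N -> (j <= k)%N -> U i j = 0) -> \det U = 0.
Proof.
move=> U0; apply: big1 => s _.
suff /existsP [i /andP [le_ki le_sik]] :
    [exists i : 'I_n, (k <= i)%N && (s i <= k)%N].
  by rewrite (bigD1 i) //= U0 // mul0r mulr0.
apply: contraT => /existsPn ngt.
pose S := [set i : 'I_n | (k <= i)%N].
have /subset_leq_card : s @: S \subset S :\ k.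
  apply/subsetP => _ /imsetP [i Si ->]; rewrite !inE in Si *.
  move: (ngt i); rewrite Si /= -ltnNge => lt_ks.
  by rewrite (ltnW lt_ks) andbT -val_eqE /= neq_ltn lt_ks orbT.
by rewrite card_imset; [rewrite (cardsD1 k S) inE leqnn ltnn | apply: perm_inj].
Qed.

Lemma conj_perm_mxE (s : 'S_n) A i j :
  ((perm_mx s)^T *m A *m perm_mx s) i j = A (s^-1%g i) (s^-1%g j).
Proof. by rewrite tr_perm_mx -row_permE -[s]invgK -col_permE !mxE invgK. Qed.

(* With M = L'^-1 L, the matrix E'^T M E = U' U^-1 is upper triangular, which *)
(* together with the unit diagonal of M forces E = E'.  It then also equals   *)
(* (E^T L' E)^-1 (E^T L E), hence is unit lower triangular, hence is 1.       *)
Lemma modified_Bruhat_uniq A L E U L' E' U' :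
  A \in unitmx -> modified_Bruhat A L E U -> modified_Bruhat A L' E' U' ->
  [/\ L' = L, E' = E & U' = U].
Proof.
move=> uA [defA ulL /is_perm_mxP [e defE] trU trLE].
move=> [defA' ulL' /is_perm_mxP [e' defE'] trU' trLE'].
have uL := unit_lower_unitmx ulL; have uL' := unit_lower_unitmx ulL'.
have [uE uE'] : E \in unitmx /\ E' \in unitmx by rewrite defE defE' !unitmx_perm.
have /andP [trL /forallP L1] := ulL; have /andP [trL' /forallP L1'] := ulL'.
have uU : U \in unitmx by move: uA; rewrite defA !unitmx_mul uL uE.
have [M defL] : exists M, L' *m M = L by exists (invmx L' *m L); rewrite mulKVmx.
have trM : is_trig_mx M.
  apply: (trig_mulmx_cancel trL'); last by rewrite defL.
  by move=> i; rewrite (eqP (L1' i)) oner_eq0.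
have M1 i : M i i = 1.
  have := trig_mulmx_diag i trL' trM.
  by rewrite defL (eqP (L1 i)) (eqP (L1' i)) mul1r.
pose T := E'^T *m M *m E.
have E'K : E' *m E'^T = 1%:M by rewrite defE' tr_perm_mx -perm_mxM mulgV perm_mx1.
have E'VK : E'^T *m E' = 1%:M by rewrite defE' tr_perm_mx -perm_mxM mulVg perm_mx1.
have defU' : T *m U = U'.
  have : L' *m (M *m E *m U) = L' *m (E' *m U').
    by rewrite !mulmxA defL -defA defA'.
  move/(can_inj (mulKmx uL')); rewrite /T -!mulmxA => ->.
  by rewrite mulmxA E'VK mul1mx.
have trT : is_trig_mx T^T.
  apply: (trig_mulmx_cancel trU); last by rewrite -trmx_mul defU'.
  by move=> i; apply: (trig_unitmx_diag _ trU); rewrite unitmx_tr.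
have eqEE' : e' = e.
  apply: eq_perm_of_leq => i; rewrite leqNgt; apply/negP => lt_ee'.
  (* The entry of [T] at [(e' i, e i)] is [M i i = 1], yet it would lie below the diagonal. *)
  have /is_trig_mxP/(_ _ _ lt_ee') := trT.
  rewrite mxE /T defE defE' tr_perm_mx -row_permE -[e]invgK -col_permE.
  rewrite !mxE invgK !permK M1.
  by move/eqP; rewrite oner_eq0.
have {}eqEE' : E' = E by rewrite defE defE' eqEE'.
have T1 : T = 1%:M.
  have LET : (E'^T *m L' *m E') *m T = E^T *m L *m E.
    by rewrite /T !mulmxA -(mulmxA _ E') E'K mulmx1 -(mulmxA _ L') defL eqEE'.
  have trT' : is_trig_mx T.
    apply: (trig_mulmx_cancel trLE'); last by rewrite LET.
    by move=> i; rewrite defE' conj_perm_mxE (eqP (L1' _)) oner_eq0.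
  apply/matrixP => i j; rewrite [RHS]mxE.
  have [lt_ij | lt_ji | /val_inj ->] := ltngtP i j.
  - by have /is_trig_mxP-> := trT'; rewrite // -val_eqE ltn_eqF.
  - have /is_trig_mxP/(_ _ _ lt_ji) := trT.
    by rewrite mxE => ->; rewrite -val_eqE gtn_eqF.
  - by rewrite eqxx /T eqEE' defE conj_perm_mxE M1.
have {}M1 : M = 1%:M.
  have : E' *m T *m E'^T = M.
    by rewrite /T eqEE' !mulmxA -eqEE' E'K mul1mx -mulmxA E'K mulmx1.
  by move=> <-; rewrite T1 mulmx1 E'K.
by split=> //; [rewrite -defL M1 mulmx1 | rewrite -defU' T1 mul1mx].
Qed.

End Triangular.

(** * Partial factorizations and the invariant of the elimination *)

Section Gauss.
Variables (F : fieldType) (n : nat).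
Implicit Types (A W : 'M[F]_n) (s t : 'S_n) (c : col_move).

(** The two factors stored in place after [k] steps: only the first [k] columns hold multipliers,
    and the rows from [k] on of [partial_U] carry the whole remaining matrix. For [k = 0] they are
    the identity and [W]; for [k = n], the final factors. *)
Definition partial_L k W : 'M[F]_n :=
  \matrix_(i, j) if (j < minn i k)%N then W i j else (i == j)%:R.

Definition partial_U k W : 'M[F]_n :=
  \matrix_(i, j) if (minn i k <= j)%N then W i j else 0.

Lemma partial_LUE k W i j : (partial_L k W *m partial_U k W) i j =
  \sum_(l < n | (l < minn i k)%N && (l <= j)%N) W i l * W l j
  + (if (minn i k <= j)%N then W i j else 0).
Proof.
rewrite mxE (bigID (fun l : 'I_n => (l < minn i k)%N)) /=; congr (_ + _).
  rewrite big_mkcondr /=; apply: eq_bigr => l lt_l; rewrite !mxE lt_l.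
  have -> : minn l k = l by lia.
  by case: ifP => _; rewrite ?mulr0.
rewrite (bigD1 i) /=; last by lia.
rewrite !mxE eqxx ltnNge geq_minl mul1r big1 ?addr0 // => l /andP [nlt ne_li].
by rewrite !mxE (negPf nlt) eq_sym (negPf ne_li) mul0r.
Qed.

Lemma partial_L_unit k W : unit_lower_triangular (partial_L k W).
Proof.
apply/andP; split; last by apply/forallP => i; rewrite mxE eqxx ltnNge geq_minl.
apply/is_trig_mxP => i j lt_ij; rewrite mxE ifN; last by lia.
by rewrite -val_eqE ltn_eqF.
Qed.

(** The storage pattern of row [i] depends only on [minn i k], which [r] preserves, so stored
    multipliers may travel with their rows. *)
Lemma partial_LU_row_perm (k : nat) W (r : 'S_n) :
  (forall p : 'I_n, (p < k)%N -> r p = p) ->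
  (forall p : 'I_n, (k <= p)%N -> (k <= r p)%N) ->
  partial_L k (row_perm r W) *m partial_U k (row_perm r W)
  = row_perm r (partial_L k W *m partial_U k W).
Proof.
move=> r_lt r_ge; apply/matrixP => i j; rewrite [RHS]mxE !partial_LUE.
have -> : minn (r i) k = minn i k.
  have [lt_ik | le_ki] := ltnP i k; first by rewrite r_lt // (minn_idPl (ltnW lt_ik)).
  by apply/minn_idPr/r_ge.
rewrite !mxE; congr (_ + _); apply: eq_bigr => l /andP [lt_l _].
by rewrite !mxE (r_lt l) //; lia.
Qed.

(** In the rows below [k], the product gains the term of index [k], which is exactly what the update
    subtracted. *)
Lemma partial_LU_eliminate (k : 'I_n) W : W k k != 0 ->
  partial_L k.+1 (eliminate k W) *m partial_U k.+1 (eliminate k W)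
  = partial_L k W *m partial_U k W.
Proof.
move=> nzW; apply/matrixP => i j; rewrite !partial_LUE.
have [le_ik | lt_ki] := leqP i k.
  have -> : minn i k.+1 = i by lia.
  rewrite !mxE ltnNge le_ik /=; congr (_ + _).
  apply: eq_bigr => l /andP [lt_li _]; rewrite !mxE !ifN //; lia.
have -> : minn i k.+1 = k.+1 by lia.
have sum_lt (P : pred 'I_n) : (forall l, P l -> (l < k)%N) ->
    \sum_(l | P l) eliminate k W i l * eliminate k W l j
    = \sum_(l | P l) W i l * W l j.
  move=> ltP; apply: eq_bigr => l /ltP lt_lk.
  by rewrite !mxE -val_eqE /= !ifN //; lia.
have [lt_jk | le_kj] := ltnP j k.
  rewrite leqNgt ltnS (ltnW lt_jk) sum_lt /=; last by lia.
  by congr (_ + _); apply: eq_bigl => l; lia.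
rewrite (bigD1 k) /=; last by lia.
rewrite sum_lt; last by move=> l; rewrite -val_eqE /=; lia.
rewrite addrAC addrC; congr (_ + _).
  by apply: eq_bigl => l; rewrite -val_eqE /=; lia.
rewrite !mxE lt_ki ltnn eqxx /=.
have [lt_kj | le_jk] := ltnP k j; first by rewrite addrC subrK.
have -> : j = k by apply/val_inj/eqP; rewrite eqn_leq le_jk le_kj.
by rewrite addr0 mulfVK.
Qed.

(** A nonzero entry in column [k] beats every later column in the reverse lexicographic order. *)
Lemma is_pivot_col (k : 'I_n) W i j :
  is_pivot k W (i, j) -> (exists2 p : 'I_n, (k <= p)%N & W p k != 0) ->
  [/\ j = k, (k <= i)%N, W i k != 0 &
      forall p : 'I_n, (k <= p)%N -> W p k != 0 -> (i <= p)%N].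
Proof.
case/andP => /and3P [/= le_ki le_kj nzW] /forallP minW [p le_kp nzWp].
have eq_jk : j = k.
  have := minW (p, k); rewrite /candidate /= le_kp leqnn nzWp /revlex_le /=.
  by rewrite ltnNge le_kj /= => /andP [/eqP].
rewrite eq_jk in minW nzW; split=> // q le_kq nzWq.
have := minW (q, k).
by rewrite /candidate /= le_kq leqnn nzWq /revlex_le /= ltnn eqxx.
Qed.

Lemma is_pivot_ex (k p : 'I_n) W : (k <= p)%N -> W p k != 0 ->
  exists u, is_pivot k W u.
Proof.
move=> le_kp nzW; pose P := [pred i : 'I_n | (k <= i)%N && (W i k != 0)].
have Pp : P p by rewrite /= le_kp.
case: (arg_minnP (fun i : 'I_n => i : nat) Pp) => i /andP [le_ki nzWi] min_i.
exists (i, k); apply/andP; split; first by rewrite /candidate /= le_ki leqnn.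
apply/forallP => [[i' j']]; apply/implyP => /and3P [/= le_ki' le_kj' nzW'].
rewrite /revlex_le /= ltn_neqAle le_kj' andbT -val_eqE.
case: eqP => //= eq_kj'; apply: min_i; rewrite /= le_ki' /=.
by have -> : k = j' by apply: val_inj.
Qed.

Lemma col_move_perm_id c (k : 'I_n) : col_move_perm c k k = 1%g.
Proof.
case: c; first exact: tperm1.
apply/permP => p; apply/val_inj; rewrite perm1 /= rotationE //.
by case: eqP => [->|] //; case: ifP => //; lia.
Qed.

(* The last conjunct says that the multipliers already computed would stay    *)
(* below the diagonal if the rows were put back in their original order.      *)
Definition gauss_invariant A k (S : gauss_state F n) : Prop :=
  let: (W, s, t) := S in
  [/\ t = 1%g, row_perm s A = partial_L k W *m partial_U k W,
      forall p q : 'I_n, (k <= p < q)%N -> (s p < s q)%N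
    & forall p q : 'I_n, (q < k)%N -> (q < p)%N -> W p q != 0 -> (s q < s p)%N].

(** Otherwise [partial_U k W] would vanish in rows from [k] on and columns up to [k], and be
    singular by [det_zero_block]. *)
Lemma gauss_invariant_pivot A k W s t (kn : (k < n)%N) : A \in unitmx ->
  gauss_invariant A k (W, s, t) ->
  exists2 p : 'I_n, (k <= p)%N & W p (Ordinal kn) != 0.
Proof.
set k' := Ordinal kn => uA [_ defA _ _].
suff /existsP [p /andP []] :
    [exists p : 'I_n, (k <= p)%N && (W p k' != 0)] by exists p.
apply: contraT => /existsPn W0.
have : row_perm s A \in unitmx by rewrite row_permE unitmx_mul unitmx_perm.
rewrite defA unitmx_mul => /andP [_].
rewrite unitmxE (@det_zero_block _ _ _ k') ?unitr0 //.
move=> i j /= le_ki le_jk; rewrite mxE; have -> : minn i k = k by lia.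
case: ifP => // le_kj; have -> : j = k' by apply/val_inj/eqP; rewrite eqn_leq le_jk.
by have := W0 i; rewrite le_ki /= negbK => /eqP.
Qed.

Lemma gauss_invariant_step A c (k : 'I_n) (S : gauss_state F n) :
  A \in unitmx -> gauss_invariant A k S ->
  gauss_invariant A k.+1 (gauss_step c S k).
Proof.
case: S => [[W s] t] uA inv.
have := gauss_invariant_pivot (ltn_ord k) uA inv.
have -> : Ordinal (ltn_ord k) = k by apply: val_inj.
move=> exW; rewrite /gauss_step; case: pickP => [[i j] pivW|none]; last first.
  by have [p le_kp /(is_pivot_ex le_kp) [u]] := exW; rewrite none.
have [-> le_ki nzW min_i] := is_pivot_col pivW exW.
rewrite col_move_perm_id col_perm1 mul1g.
case: inv => -> defA s_mono s_mult.
set r := rotation k i.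
have rE p := rotationE p le_ki; rewrite -/r in rE.
have r_k : r k = i by apply/val_inj; rewrite /= rE eqxx.
have r_lt (p : 'I_n) : (p < k)%N -> r p = p.
  move=> lt_pk; apply/val_inj.
  by rewrite /= rE -val_eqE ltn_eqF // ltnNge (ltnW lt_pk).
have r_ge (p : 'I_n) : (k <= p)%N -> (k <= r p)%N.
  by move=> le_kp; rewrite rE; case: eqP => // _; case: ifP => //; lia.
(* This is where rotations matter: a transposition could break the order of the remaining rows. *)
have r_mono (p q : 'I_n) : (k < p < q)%N -> (k <= r p < r q)%N.
  move=> lt_kpq; rewrite !rE -!val_eqE /= !gtn_eqF; try lia.
  by do 2![case: ifP]; lia.
split=> //.
- rewrite partial_LU_eliminate; last by rewrite mxE r_k.
  by rewrite partial_LU_row_perm // -defA row_permM.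
- by move=> p q /r_mono lt_r; rewrite !permM s_mono.
move=> p q; rewrite ltnS leq_eqVlt => /predU1P [/val_inj -> | lt_qk] lt_qp.
  (* A new nonzero multiplier comes from a row [r p] with a nonzero entry in column [k], hence
     strictly below the topmost one, [i]; the order of unprocessed rows carries this over to [s]. *)
  rewrite !mxE lt_qp ltnn eqxx /= mulf_eq0 negb_or => /andP [nzWp _].
  have le_kp := r_ge _ (ltnW lt_qp).
  rewrite !permM r_k s_mono // le_ki ltn_neqAle min_i // andbT.
  by rewrite -r_k val_eqE (inj_eq perm_inj) -val_eqE ltn_eqF.
rewrite !mxE [(k < q)%N]ltnNge (ltnW lt_qk) andbF -val_eqE (ltn_eqF lt_qk) andbF.
rewrite !permM (r_lt q) //; apply: s_mult => //.
have [lt_pk | /r_ge] := ltnP p k; [by rewrite r_lt | exact: leq_trans].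
Qed.

Lemma gauss_invariant_final A c : A \in unitmx -> gauss_invariant A n (gauss c A).
Proof.
move=> uA; rewrite /gauss.
suff IH m : (m <= n)%N ->
    gauss_invariant A m (foldl (gauss_step c) (A, 1%g, 1%g) (take m (enum 'I_n))).
  by have := IH n (leqnn n); rewrite take_oversize ?size_enum_ord.
elim: m => [_ | m IHm lt_mn].
  rewrite take0 /=; split=> // [|p q].
    rewrite row_perm1; apply/matrixP => i j.
    by rewrite partial_LUE minn0 big_pred0 // add0r.
  by rewrite !perm1.
rewrite (take_nth (Ordinal lt_mn)) ?size_enum_ord // -cats1 foldl_cat /=.
have -> : nth (Ordinal lt_mn) (enum 'I_n) m = Ordinal lt_mn.
  by apply/val_inj; rewrite /= nth_enum_ord.
exact: (@gauss_invariant_step A c (Ordinal lt_mn) _ uA (IHm (ltnW lt_mn))).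
Qed.

End Gauss.

Theorem corollary23 (F : fieldType) (n : nat) (A : 'M[F]_n)
    (hA : A \in unitmx) (c : col_move) (P L U Q : 'M[F]_n)
    (hPLUQ : gauss_PLUQ c A P L U Q) :
  let Lbar := P *m L *m P^T in
  let E := P *m Q in
  let Ubar := Q^T *m U *m Q in
  modified_Bruhat A Lbar E Ubar /\
  (forall L' E' U' : 'M[F]_n, modified_Bruhat A L' E' U' ->
    [/\ L' = Lbar, E' = E & U' = Ubar]).
Proof.
move=> Lbar E Ubar.
suff mB : modified_Bruhat A Lbar E Ubar.
  by split=> // L' E' U'; apply: modified_Bruhat_uniq.
move: hPLUQ; rewrite /gauss_PLUQ; have := gauss_invariant_final c hA.
case: (gauss c A) => [[W s] t] [-> defA _ mult] [defP defL defU defQ].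
have Ln : L = partial_L n W.
  rewrite defL; apply/matrixP => i j.
  by rewrite !mxE (minn_idPl (ltnW (ltn_ord i))).
have Un : U = partial_U n W.
  rewrite defU; apply/matrixP => i j.
  by rewrite !mxE (minn_idPl (ltnW (ltn_ord i))).
have /andP [trL /forallP L1] := partial_L_unit n W.
rewrite -Ln in trL L1.
have PK : P^T *m P = 1%:M by rewrite defP tr_perm_mx -perm_mxM mulVg perm_mx1.
have Q1 : Q = 1%:M by rewrite defQ perm_mx1.
have LbarE i j : Lbar i j = L (s^-1%g i) (s^-1%g j).
  by rewrite /Lbar defP tr_perm_mx -row_permE -col_permE !mxE.
rewrite /Ubar /E Q1 trmx1 !mulmx1 mul1mx; split.
- rewrite /Lbar -(mulmxA _ _ P) PK mulmx1 -mulmxA Ln Un -defA defP -row_permE.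
  by rewrite -row_permM mulVg row_perm1.
- apply/andP; split; last by apply/forallP => i; rewrite LbarE.
  apply/is_trig_mxP => i j lt_ij; rewrite LbarE defL mxE; case: ifP => [lt_s | _].
    (* A nonzero multiplier here would give [j < i] in the original row order. *)
    apply/eqP/negPn/negP => /(mult _ _ (ltn_ord _) lt_s); rewrite !permKV; lia.
  by rewrite (inj_eq perm_inj) -val_eqE ltn_eqF.
- by apply/is_perm_mxP; exists s^-1%g.
- apply/is_trig_mxP => i j lt_ij.
  by rewrite Un !mxE (minn_idPl (ltnW (ltn_ord j))) leqNgt lt_ij.
by rewrite /Lbar !mulmxA PK mul1mx -mulmxA PK mulmx1.
Qed.
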